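(* Let each $f_i:\mathbb{R}\to\mathbb{R}$, $i\in[N]$, be convex and differentiable with $|f_i'(s)-f_i'(t)|\le L_i|s-t|$ for all $s,t\in\mathbb{R}$, where $L_i>0$. Let $x^0\in S$ and let $R_1,\dots,R_N>0$ be constants such that for any $x$ satisfying $f(x)\le f(x^0)$ there exists $x^*\in X^*$ with $|x_i-x_i^*|\le R_i$ for all $i\in[N]$. Then the optimal value of the following semidefinite program, whose solutions provide a (suboptimal) choice of probabilities $(p_{\mathcal N})_{\mathcal N\in\mathcal P_\tau}$, is an upper bound on $(\mathcal R^*(x^0))^2$: $$\left(\mathcal R^*(x^0)\right)^2\le\min_{G_\tau\in\mathcal M,\ \zeta\ge0,\ \nu\ge0}\left\{\sum_{i=1}^N\nu_iR_i^2:\ \begin{bmatrix}G_\tau+\zeta ee^T& I_N\\ I_N& D_\nu\end{bmatrix}\succeq0\right\},$$ where $\zeta\in\mathbb{R}$ and $\nu=(\nu_1,\dots,\nu_N)\in\mathbb{R}^N$.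
   Context: Problem: $f^*=\min\{f(x): x\in S\}$, where $f(x)=\sum_{i=1}^N f_i(x_i)$ for $x\in\mathbb{R}^N$ and $S=\{x\in\mathbb{R}^N:\sum_{i=1}^N x_i=0\}$; $X^*\subseteq S$ is the set of optimal solutions. $[N]=\{1,\dots,N\}$, $e\in\mathbb{R}^N$ is the all-ones vector, $I_N$ the identity, $D_\nu$ the diagonal matrix with diagonal $\nu$. $2\le\tau\le N$ is an integer and $\mathcal P_\tau$ is the set of paths of $\tau$ vertices in the complete graph on $[N]$, each identified with its vertex set (so all $\tau$-element subsets of $[N]$). For $\mathcal N\in\mathcal P_\tau$ let $\ell_{\mathcal N}\in\mathbb{R}^N$ have entries $1/L_i$ for $i\in\mathcal N$ and $0$ otherwise, and let $G_{\mathcal N}=\mathrm{diag}(\ell_{\mathcal N})-\frac{1}{\sum_{i\in\mathcal N}1/L_i}\,\ell_{\mathcal N}\ell_{\mathcal N}^T$. The set $\mathcal M$ consists of all matrices $G_\tau=\sum_{\mathcal N\in\mathcal P_\tau}p_{\mathcal N}G_{\mathcal N}$ with $(p_{\mathcal N})$ a probability distribution on $\mathcal P_\tau$. For $G_\tau\in\mathcal M$ and $x\in S$: $\|x\|^*_{G_\tau}=\sup\{\langle x,u\rangle:u\in\mathbb{R}^N,\ u^TG_\tau u\le1\}\in[0,\infty]$. For a given distribution $p=(p_{\mathcal N})$ with associated matrix $G_\tau$, $\mathcal R(x^0)=\max_{x\in S,\ f(x)\le f(x^0)}\min_{x^*\in X^*}\|x-x^*\|^*_{G_\tau}$, and $\mathcal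 R^*(x^0)=\min_p\mathcal R(x^0)$ is the minimum over all probability distributions $p$ on $\mathcal P_\tau$. Max and min are understood as supremum and infimum where not attained. *)

(* Defs.v *)
From mathcomp Require Import all_boot all_order all_algebra.
From mathcomp Require Import all_classical all_reals all_analysis.

Set Implicit Arguments.
Unset Strict Implicit.
Unset Printing Implicit Defensive.

Import Order.TTheory GRing.Theory Num.Theory.
Import numFieldNormedType.Exports.

Local Open Scope classical_set_scope.
Local Open Scope ring_scope.

(** Vectors of R^N are column vectors; "max" and "min" are [ereal_sup] and
    [ereal_inf] in [\bar R], so that they make sense when not attained. *)

Section separable_problem.
Context {R : realType} {N : nat}.
Implicit Types (x y u : 'cV[R]_N) (fs : 'I_N -> R -> R).

Definition objective fs x : R := \sum_i fs i (x i 0).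

Definition feasible : set 'cV[R]_N := [set x | \sum_i x i 0 = 0].

Definition optimal fs : set 'cV[R]_N :=
  [set x | feasible x /\ forall y, feasible y -> objective fs x <= objective fs y].

End separable_problem.

Section sampling_matrices.
Context {R : realType} {N : nat}.
Implicit Types (A : {set 'I_N}) (L : 'I_N -> R) (p : {set 'I_N} -> R).

(** In the complete graph every set of [tau] vertices is the vertex set of a
    path, so paths identified with their vertex sets are [tau]-subsets. *)
Definition path_sets (tau : nat) : {set {set 'I_N}} :=
  [set A : {set 'I_N} | #|A| == tau]%SET.

(** The values of [p] outside [path_sets tau] are irrelevant: they are
    used neither here nor in [Gtau]. *)
Definition path_distribution (tau : nat) : set ({set 'I_N} -> R) :=
  [set p | (forall A, A \in path_sets tau -> 0 <= p A) /\
           \sum_(A in path_sets tau) p A = 1].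

Definition ell L A : 'cV[R]_N := \col_i (if i \in A then (L i)^-1 else 0).

Definition Gpath L A : 'M[R]_N :=
  diag_mx (ell L A)^T
  - (\sum_(i in A) (L i)^-1)^-1 *: (ell L A *m (ell L A)^T).

Definition Gtau L (tau : nat) p : 'M[R]_N :=
  \sum_(A in path_sets tau) p A *: Gpath L A.

Definition Gset L (tau : nat) : set 'M[R]_N :=
  [set Gtau L tau p | p in path_distribution tau].

End sampling_matrices.

Section radius.
Context {R : realType} {N : nat}.
Implicit Types (G : 'M[R]_N) (fs : 'I_N -> R -> R) (L : 'I_N -> R).

Definition dual_norm G (x : 'cV[R]_N) : \bar R :=
  ereal_sup [set ((x^T *m u) 0 0)%:E | u in
             [set u : 'cV[R]_N | (u^T *m G *m u) 0 0 <= 1]].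

(** [calR] depends on the distribution only through its matrix [G]. *)
Definition calR fs G (x0 : 'cV[R]_N) : \bar R :=
  ereal_sup
    [set ereal_inf [set dual_norm G (x - xs) | xs in optimal fs] | x in
     [set x | feasible x /\ objective fs x <= objective fs x0]].

Definition calRstar fs L (tau : nat) (x0 : 'cV[R]_N) : \bar R :=
  ereal_inf [set calR fs (Gtau L tau p) x0 | p in path_distribution tau].

End radius.

Section sdp.
Context {R : realType}.

Definition psd (n : nat) (A : 'M[R]_n) : Prop :=
  A^T = A /\ forall v : 'cV[R]_n, 0 <= (v^T *m A *m v) 0 0.

Definition ones (N : nat) : 'cV[R]_N := const_mx 1.

Definition sdp_feasible (N : nat) (L : 'I_N -> R) (tau : nat)
    (G : 'M[R]_N) (zeta : R) (nu : 'rV[R]_N) : Prop :=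
  [/\ Gset L tau G, 0 <= zeta, (forall i, 0 <= nu 0 i) &
      psd (block_mx (G + zeta *: (ones N *m (ones N)^T)) 1%:M
                    1%:M (diag_mx nu))].

Definition sdp_value (N : nat) (L : 'I_N -> R) (tau : nat) (Rad : 'I_N -> R) :
    \bar R :=
  ereal_inf [set r : \bar R | exists G zeta nu,
    sdp_feasible L tau G zeta nu /\ r = (\sum_i nu 0 i * Rad i ^+ 2)%:E].

End sdp.

(* Main.v *)
(** If [G e = 0], the vector [u] in the definition of the dual norm may be
    projected onto the orthogonal complement of [e] without changing [u^T G u]
    or [<d, u>] for feasible [d]. For such [u] the [zeta] term vanishes, and
    testing the semidefinite constraint on [(u, - t d)] gives
    [u^T G u - 2 t <d, u> + t^2 \sum_i nu_i d_i^2 >= 0] for every [t], so that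
    [<d, u>^2 <= \sum_i nu_i d_i^2] by the discriminant. *)
Require Import Defs.
From mathcomp Require Import all_boot all_order all_algebra.
From mathcomp Require Import all_classical all_reals all_analysis.
From mathcomp Require Import ring lra.

Import Order.TTheory GRing.Theory Num.Theory.
Import numFieldNormedType.Exports.
Local Open Scope classical_set_scope.
Local Open Scope ring_scope.

(** For [M > 0] the quadratic is tested at its minimiser [t = a / M]. For [M = 0] it is affine in
    [t], and [t = a^-1] would give the value [-1] unless [a = 0]. *)
Lemma sqr_le_of_quadratic_ge0 (R : realFieldType) (a M : R) :
  0 <= M -> (forall t, 0 <= 1 - 2 * t * a + t ^+ 2 * M) -> a ^+ 2 <= M.
Proof.
move=> M0 ht; have [M_eq0|Mn0] := eqVneq M 0.
  rewrite M_eq0 in ht *.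
  have [->|an0] := eqVneq a 0; first by rewrite expr0n.
  have := ht a^-1; rewrite mulr0 -mulrA mulVf //; lra.
have Mgt0 : 0 < M by rewrite lt0r Mn0.
have := ht (a / M).
have -> : 1 - 2 * (a / M) * a + (a / M) ^+ 2 * M = (M - a ^+ 2) / M by field.
by rewrite pmulr_lge0 ?invr_gt0 // subr_ge0.
Qed.

Section path_matrices.
Context {R : realType} {N : nat}.
Implicit Types (A : {set 'I_N}) (L : 'I_N -> R) (p : {set 'I_N} -> R).
Implicit Types (G : 'M[R]_N) (u d : 'cV[R]_N).

Lemma tr_Gpath L A : (Gpath L A)^T = Gpath L A.
Proof. by rewrite /Gpath linearB linearZ /= trmx_mul trmxK tr_diag_mx. Qed.

(** The product of [(ell L A)^T] with [ones N] is exactly the normalising sum, so both terms of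
    [Gpath] send [ones N] to [ell L A]. *)
Lemma Gpath_ones L A : \sum_(i in A) (L i)^-1 != 0 ->
  Gpath L A *m ones N = 0.
Proof.
move=> s0; rewrite /Gpath mulmxBl -scalemxAl -mulmxA.
have -> : (ell L A)^T *m ones N = (\sum_(i in A) (L i)^-1)%:M.
  apply/matrixP => i j; rewrite !ord1 !mxE eqxx mulr1n [RHS]big_mkcond /=.
  by apply: eq_bigr => k _; rewrite !mxE mulr1.
rewrite mul_mx_scalar scalerA mulVf // scale1r.
apply/matrixP => i j; rewrite mul_diag_mx !mxE.
by rewrite mulr1 subrr.
Qed.

Lemma tr_Gtau L tau p : (Gtau L tau p)^T = Gtau L tau p.
Proof.
rewrite /Gtau linear_sum /=; apply: eq_bigr => A _.
by rewrite linearZ /= tr_Gpath.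
Qed.

Lemma Gtau_ones L tau p : (0 < tau)%N -> (forall i, 0 < L i) ->
  Gtau L tau p *m ones N = 0.
Proof.
move=> tau0 hL; rewrite /Gtau mulmx_suml big1 // => A.
rewrite inE => /eqP cA; rewrite -scalemxAl Gpath_ones ?scaler0 //.
(* A nonempty path makes the normalising sum positive. *)
have /card_gt0P [i iA] : (0 < #|A|)%N by rewrite cA.
rewrite gt_eqF // (bigD1 i) //= ltr_pwDl ?invr_gt0 //.
by apply: sumr_ge0 => j _; rewrite invr_ge0 ltW.
Qed.

(** By symmetry [ones N] is annihilated on the left as well, so all cross terms vanish. *)
Lemma quad_sub_ones G u t : G^T = G -> G *m ones N = 0 ->
  (u - t *: ones N)^T *m G *m (u - t *: ones N) = u^T *m G *m u.
Proof.
move=> Gsym Ge; have eG : (ones N)^T *m G = 0.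
  by rewrite -[G]Gsym -trmx_mul Ge trmx0.
have -> : (u - t *: ones N)^T = u^T - t *: (ones N)^T.
  by rewrite linearB linearZ.
rewrite mulmxBl -scalemxAl eG scaler0 subr0.
by rewrite mulmxBr -scalemxAr -!mulmxA Ge mulmx0 scaler0 subr0.
Qed.

(** The block form is evaluated at [col_mx u d]; its two identity blocks contribute equal scalars,
    whence the factor 2. *)
Lemma psd_block_quad G (nu : 'rV[R]_N) u d :
  psd (block_mx G 1%:M 1%:M (diag_mx nu)) ->
  0 <= (u^T *m G *m u) 0 0 + 2 * (d^T *m u) 0 0 +
       \sum_i nu 0 i * d i 0 ^+ 2.
Proof.
case=> _ /(_ (col_mx u d)).
rewrite tr_col_mx mul_row_block mul_row_col !mulmxDl !mulmx1.
have -> : d^T *m diag_mx nu *m d = (\sum_i nu 0 i * d i 0 ^+ 2)%:M.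
  rewrite mul_mx_diag.
  apply/matrixP => i j; rewrite !ord1 !mxE eqxx mulr1n.
  by apply: eq_bigr => k _; rewrite !mxE; ring.
have -> : u^T *m d = d^T *m u.
  by apply/matrixP => i j; rewrite !ord1 !mxE; apply: eq_bigr => k _;
    rewrite !mxE mulrC.
have entryD (B C : 'M[R]_1) : (B + C) 0 0 = B 0 0 + C 0 0 by rewrite mxE.
rewrite !entryD [(_%:M) 0 0]mxE eqxx mulr1n; lra.
Qed.

Lemma dual_norm_ge0 G d : (0 <= dual_norm G d)%E.
Proof.
apply: ereal_sup_ubound; exists 0; last by rewrite mulmx0 mxE.
by rewrite /= mulmx0 mxE ler01.
Qed.

Lemma dual_norm_le_sdp G zeta (nu : 'rV[R]_N) d :
  (0 < N)%N -> G^T = G -> G *m ones N = 0 -> (forall i, 0 <= nu 0 i) ->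
  psd (block_mx (G + zeta *: (ones N *m (ones N)^T)) 1%:M
                1%:M (diag_mx nu)) ->
  feasible d ->
  (dual_norm G d <= (Num.sqrt (\sum_i nu 0 i * d i 0 ^+ 2))%:E)%E.
Proof.
move=> N0 Gsym Ge nu0 hpsd hd; apply: ge_ereal_sup => _ [u /= hu <-].
rewrite lee_fin.
set M := \sum_i _.
have M0 : 0 <= M by apply: sumr_ge0 => i _; rewrite mulr_ge0 ?sqr_ge0.
(* [m] is the mean of [u], so [v] is the orthogonal projection of [u] onto the complement of
   [ones N]. *)
pose m := (\sum_i u i 0) / N%:R.
pose v := u - m *: ones N.
have de : d^T *m ones N = 0.
  apply/matrixP => i j; rewrite !ord1 !mxE -[RHS]hd.
  by apply: eq_bigr => k _; rewrite !mxE mulr1.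
have ev : (ones N)^T *m v = 0.
  apply/matrixP => i j; rewrite !ord1 !mxE.
  under eq_bigr do rewrite !mxE mul1r mulr1.
  rewrite sumrB sumr_const card_ord -[m *+ N]mulr_natr divfK ?subrr //.
  by rewrite pnatr_eq0 -lt0n.
have -> : d^T *m u = d^T *m v.
  by rewrite mulmxBr -scalemxAr de scaler0 subr0.
have qv : v^T *m G *m v = u^T *m G *m u by exact: quad_sub_ones.
clearbody v.
apply: (le_trans (ler_norm _)); rewrite -sqrtr_sqr ler_wsqrtr //.
apply: sqr_le_of_quadratic_ge0 => // t.
have := psd_block_quad _ _ v (- t *: d) hpsd.
have -> : v^T *m (G + zeta *: (ones N *m (ones N)^T)) *m v
          = u^T *m G *m u.
  rewrite mulmxDr mulmxDl -scalemxAr -scalemxAl -!mulmxA ev !mulmx0.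
  by rewrite scaler0 addr0 !mulmxA qv.
have -> : ((- t *: d)^T *m v) 0 0 = - t * (d^T *m v) 0 0.
  by rewrite linearZ /= -scalemxAl mxE.
under eq_bigr => i _ do rewrite mxE exprMn sqrrN mulrCA.
rewrite -mulr_sumr -/M => h.
(* The constraint [hu] replaces the constant term [u^T G u] by 1. *)
by apply: (le_trans h); lra.
Qed.

End path_matrices.

Theorem theorem4p1 (R : realType) (N tau : nat) (htau : (2 <= tau <= N)%N)
    (fs : 'I_N -> R -> R) (L Rad : 'I_N -> R) (x0 : 'cV[R]_N)
    (hconv : forall i, convex_function [set: R^o] (fs i))
    (hdiff : forall i (t : R), derivable (fs i) t 1)
    (hL : forall i, 0 < L i)
    (hlip : forall i (s t : R),
        `|derive1 (fs i) s - derive1 (fs i) t| <= L i * `|s - t|)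
    (hx0 : feasible x0)
    (hRad : forall i, 0 < Rad i)
    (hdist : forall x : 'cV[R]_N, objective fs x <= objective fs x0 ->
        exists2 xs : 'cV[R]_N, optimal fs xs &
          forall i, `|x i 0 - xs i 0| <= Rad i) :
  ((calRstar fs L tau x0) ^+ 2 <= sdp_value L tau Rad)%E.
Proof.
have [tau0 N0] : (0 < tau)%N /\ (0 < N)%N.
  by case/andP: htau => /ltnW tau0 /(leq_trans tau0).
apply: le_ereal_inf_tmp => _ [_ [zeta [nu [[[p hp <-] _ nu0 hpsd] ->]]]].
set M := \sum_i _.
have M0 : 0 <= M by apply: sumr_ge0 => i _; rewrite mulr_ge0 ?sqr_ge0.
have star0 : (0 <= calRstar fs L tau x0)%E.
  apply: le_ereal_inf_tmp => _ [q _ <-].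
  (* [x0] lies in its own level set, so the supremum is not the empty one, which would be [-oo]. *)
  apply: le_trans (ereal_sup_ubound _); last by exists x0.
  by apply: le_ereal_inf_tmp => _ [xs _ <-]; exact: dual_norm_ge0.
have starM : (calRstar fs L tau x0 <= (Num.sqrt M)%:E)%E.
  (* The distribution behind the SDP matrix is one candidate in the minimum over distributions. *)
  apply: (@le_trans _ _ (calR fs (Gtau L tau p) x0)).
    by apply: ereal_inf_lbound; exists p.
  apply: ge_ereal_sup => _ [x [hx hfx] <-].
  have [xs hxs hle] := hdist x hfx.
  apply: (@le_trans _ _ (dual_norm (Gtau L tau p) (x - xs))).
    by apply: ereal_inf_lbound; exists xs.
  have hd : feasible (x - xs).
    rewrite /feasible /=; under eq_bigr do rewrite !mxE.
    by rewrite sumrB hx hxs.1 subrr.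
  apply: le_trans (dual_norm_le_sdp _ _ _ _ N0 (tr_Gtau _ _ _)
    (Gtau_ones _ _ _ tau0 hL) nu0 hpsd hd) _.
  (* Since [nu] is nonnegative, the coordinatewise bounds by [Rad] pass to the weighted sum of
     squares. *)
  rewrite lee_fin ler_wsqrtr //; apply: ler_sum => i _.
  rewrite ler_wpM2l // !mxE -real_normK ?num_real //.
  by apply: lerXn2r; rewrite ?nnegrE //; exact: ltW.
(* Squaring preserves the bound because [star0] excludes negative values. *)
apply: (@le_trans _ _ ((Num.sqrt M)%:E ^+ 2)%E).
  by rewrite !expe2 lee_pmul.
by rewrite -EFin_expe sqr_sqrtr.
Qed.
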